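(* Let $M > 0$ be a real number. Then there exist infinitely many simplest cubic fields $K_n$ such that $|Po(K_n)| > M$.
   Context: For an integer $n$, the simplest cubic field (Shanks' family) $K_n$ is the splitting field over $\mathbb{Q}$ of the irreducible polynomial $f_n(X) = X^3 + (n+3)X^2 + nX - 1$. For a number field $K$ with ring of integers $\mathcal{O}_K$ and ideal class group $Cl_K$, and for a prime power $q$, let $\Pi_q(K)$ be the product of all prime ideals $\mathfrak{p}$ of $\mathcal{O}_K$ with $N_{K/\mathbb{Q}}\mathfrak{p} = q$; if there are no such prime ideals, set $\Pi_q(K) = \mathcal{O}_K$. The Pólya group $Po(K)$ is the subgroup of $Cl_K$ generated by the ideal classes $[\Pi_q(K)]$ as $q$ ranges over all prime powers. *)

(* Defs.v *)
From HB Require Import structures.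
From mathcomp Require Import all_boot all_order all_algebra all_field.
From mathcomp Require Import finmap all_classical all_reals.
From mathcomp Require Import ereal counting_measure.

Set Implicit Arguments.
Unset Strict Implicit.
Unset Printing Implicit Defensive.

Import Order.TTheory GRing.Theory Num.Theory.

Local Open Scope classical_set_scope.
Local Open Scope ring_scope.

Section NumberField.
Variable K : fieldExtType rat.
Implicit Types (I J P : set K) (c d : set (set K)) (q : nat).

Definition ring_of_integers : set K :=
  [set x | integralOver (intr : int -> K) x].
Local Notation OK := ring_of_integers.

Definition OK_submodule I : Prop :=
  [/\ I 0, forall x y, I x -> I y -> I (x + y)
    & forall a x, OK a -> I x -> I (a * x)].

Definition integral_ideal I : Prop := OK_submodule I /\ I `<=` OK.

Definition prime_ideal P : Prop :=
  [/\ integral_ideal P, ~ P 1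
    & forall a b, OK a -> OK b -> P (a * b) -> P a \/ P b].

Definition fractional_ideal I : Prop :=
  [/\ OK_submodule I, exists2 x, I x & x != 0
    & exists d : K, [/\ OK d, d != 0 & forall x, I x -> OK (d * x)]].

Definition ideal_mul I J : set K :=
  [set x | exists s : seq (K * K),
     (forall p, p \in s -> I p.1 /\ J p.2) /\ x = \sum_(p <- s) p.1 * p.2].

Definition ideal_cosets I : set (set K) :=
  [set [set x + y | y in I] | x in OK].

(* The absolute norm #|OK / I|, with value 0 when the quotient is infinite,   *)
(* i.e. for I = 0; hence the zero ideal never has a prime power as its norm.  *)
Definition ideal_norm I : nat := #|` fset_set (ideal_cosets I)|%fset.

Definition prime_power q : Prop :=
  exists p k : nat, [/\ prime p, (0 < k)%N & q = (p ^ k)%N].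

(* Only finitely many primes have a given norm, so fset_set, which is empty   *)
(* on infinite sets, enumerates exactly the primes of norm q.                 *)
Definition Pi_ideal q : set K :=
  \big[ideal_mul/OK]_(P <- fset_set [set P | prime_ideal P /\ ideal_norm P = q])
    P.

Definition ideal_class I : set (set K) :=
  [set J | exists2 a : K, a != 0 & J = [set a * x | x in I]].

Definition class_group : set (set (set K)) :=
  [set ideal_class I | I in fractional_ideal].

Definition class_mul c d : set (set K) :=
  [set ideal_mul I J | I in c & J in d].

Definition class_subgroup (H : set (set (set K))) : Prop :=
  [/\ H `<=` class_group, H (ideal_class OK),
      forall c d, H c -> H d -> H (class_mul c d)
    & forall c d, H c -> class_group d ->
        class_mul c d = ideal_class OK -> H d].

Definition polya_group : set (set (set K)) :=
  smallest class_subgroup [set ideal_class (Pi_ideal q) | q in prime_power].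

End NumberField.

Arguments polya_group K : clear implicits.

Definition shanks_poly (n : int) : {poly rat} :=
  'X^3 + (n + 3)%:~R *: 'X^2 + n%:~R *: 'X - 1.

Definition is_simplest_cubic_field (n : int) (K : fieldExtType rat) : Prop :=
  splittingFieldFor 1%VS (map_poly (in_alg K) (shanks_poly n)) {:K}%VS.

(* Ring morphisms between characteristic 0 fields are Q-linear.               *)
Definition field_isomorphic (K L : fieldExtType rat) : Prop :=
  exists f : {rmorphism K -> L}, bijective f.

(* Main.v *)
Require Import Defs.
From HB Require Import structures.
From mathcomp Require Import all_boot all_order all_algebra all_field.
From mathcomp Require Import finmap all_classical all_reals.
From mathcomp Require Import ereal counting_measure.
From mathcomp Require Import ring zify.

(* For n = 3 k put d = k^2 + k + 1 and y = rho + k + 1, where rho is a root   *)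
(* of the Shanks polynomial; then y^3 = 3 d y - (2 k + 1) d, which is         *)
(* Eisenstein at every prime p <> 3 dividing d exactly once. Such a p has a   *)
(* unique prime P_p of norm p, and O / P_p = F_p shows that the norm of any   *)
(* integer of K is a cube modulo p. If P_p = a P_p', then b = p' a is an      *)
(* integer of norm +- p p'^2, so p p'^2 is a cube modulo every other ramified *)
(* prime q. This gives a lower bound for the Polya group without any unit     *)
(* theorem: it suffices to find many primes, pairwise separated by the cubic  *)
(* residue symbols at auxiliary primes q, and then k with all of them         *)
(* dividing k^2 + k + 1 exactly once. The separated primes are found among    *)
(* the prime factors of numbers x^2 + x + 1 with prescribed symbols, by a     *)
(* rank argument over F_3.                                                    *)

Set Implicit Arguments.
Unset Strict Implicit.
Unset Printing Implicit Defensive.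

Import Order.TTheory GRing.Theory Num.Theory.

(** Take n = 3 k. A prime p other than 3 dividing d = k^2 + k + 1 exactly once is totally ramified,
    so [Pi_ideal p] is the single prime P_p of norm p ([Pi_ideal_prime_over]) and its class lies in
    the Polya group. Many of these classes must be kept apart. If P_p and P_p' had the same class,
    some integer of K would have norm +- p p'^2; norms of integers are cubes modulo every totally
    ramified q ([cnorm_residue]), so one such q modulo which p p'^2 is not a cube separates the two
    classes ([prime_over_class_neq]).

    [exists_config] supplies k. Values x^2 + x + 1 with prescribed cubic symbols at t + 1 auxiliary
    primes have independent symbol vectors over F_3. These vectors are sums of those of prime
    factors, so t + 1 of the prime factors have independent, hence distinct, vectors. The Chinese
    remainder theorem puts all the primes into one d.

    For infinitely many fields, each K also gets a totally ramified prime above a given B, which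
    [cube_residues] recognises up to isomorphism, while [unramified_not_cube] bounds the primes so
    recognised by 9 d. Taking B beyond the bounds of the earlier fields makes the fields pairwise
    non-isomorphic. *)

(** * Prime divisors of x^2 + x + 1 *)

Definition cyc3 (x : nat) : nat := (x ^ 2 + x + 1)%N.

Definition ramified (p k : nat) : Prop :=
  [/\ prime p, p != 3, p %| cyc3 k & ~~ (p ^ 2 %| cyc3 k)]%N.

(** Euclid's argument at x = B!: a prime factor at most B would divide B! and hence 1. *)
Lemma cyc3_prime_gt (B : nat) :
  exists q z : nat, [/\ prime q, (B < q)%N & (q %| cyc3 z)%N].
Proof.
exists (pdiv (cyc3 B`!)), B`!.
have gt1 : (1 < cyc3 B`!)%N by rewrite /cyc3; have := fact_gt0 B; nia.
split; [exact: pdiv_prime | | exact: pdiv_dvd].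
rewrite ltnNge; apply/negP => le_qB.
have dq : (pdiv (cyc3 B`!) %| B`!)%N by rewrite dvdn_fact ?pdiv_gt0.
have := pdiv_dvd (cyc3 B`!); rewrite {2}/cyc3 dvdn_addr; last first.
  by rewrite dvdn_addr // (dvdn_trans dq) // dvdn_exp.
by rewrite dvdn1 => /eqP q1; have := pdiv_prime gt1; rewrite q1.
Qed.

Lemma crt_seq (l : seq nat) (M r : nat -> nat) :
  uniq l -> {in l &, forall p q, p != q -> coprime (M p) (M q)} ->
  exists k, {in l, forall p, k = r p %[mod M p]}.
Proof.
elim: l => [_ _|a l IH /= /andP[al Ul] coM]; first by exists 0.
have [//|k kP] := IH Ul.
  by move=> p q pl ql; apply: coM; rewrite inE ?pl ?ql orbT.
have co : coprime (M a) (\prod_(p <- l) M p).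
  rewrite big_seq; elim/big_ind: _ => [|x y|p pl]; first exact: coprimen1.
    by rewrite coprimeMr => -> ->.
  apply: coM; rewrite ?inE ?eqxx ?pl ?orbT //.
  by apply: contraNneq al => ->.
exists (chinese (M a) (\prod_(p <- l) M p) (r a) k) => p.
rewrite inE => /orP[/eqP->|pl]; first by rewrite chinese_modl.
rewrite -kP //.
have dv : (M p %| \prod_(p <- l) M p)%N by rewrite (big_rem p) //= dvdn_mulr.
have /(congr1 (fun x => x %% M p)%N) := chinese_modr co (r a) k.
by rewrite !modn_dvdm.
Qed.

Lemma cyc3_mod (m x y : nat) : x = y %[mod m] -> cyc3 x = cyc3 y %[mod m].
Proof.
move=> xy; rewrite /cyc3; apply/eqP; rewrite eqn_modDr; apply/eqP.
by rewrite -modnDm -modnXm xy modnXm modnDm.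
Qed.

(** The derivative 2 x + 1 is a unit modulo p, since (2 x + 1)^2 + 3 = 4 (x^2 + x + 1) and p is not
    3; so if p^2 divides the value at x, it does not divide the value at x + p. *)
Lemma cyc3_lift (p x : nat) : prime p -> p != 3 -> (p %| cyc3 x)%N ->
  exists k, (p %| cyc3 k)%N /\ ~~ (p ^ 2 %| cyc3 k)%N.
Proof.
move=> pp p3 px; case: (boolP (p ^ 2 %| cyc3 x)%N) => [p2|]; last by exists x.
have E : cyc3 (x + p) = (cyc3 x + p * (2 * x + 1) + p ^ 2)%N.
  by rewrite /cyc3; ring.
exists (x + p)%N; rewrite E; split.
  by apply: dvdn_add; [apply: dvdn_add => //; exact: dvdn_mulr | exact: dvdn_exp].
rewrite dvdn_addl // dvdn_addr // expnS expn1 dvdn_pmul2l ?prime_gt0 //.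
apply/negP => d2; have : (p %| (2 * x + 1) ^ 2 + 3)%N.
  have -> : ((2 * x + 1) ^ 2 + 3 = 4 * cyc3 x)%N by rewrite /cyc3; ring.
  by rewrite dvdn_mull.
rewrite dvdn_addr; last by rewrite dvdn_exp.
by rewrite dvdn_prime2 // => /eqP pE; rewrite pE in p3.
Qed.

(** For each p the condition depends only on k modulo p^2, and these moduli are coprime. *)
Lemma exists_ramified (l : seq nat) :
  uniq l -> {in l, forall p, [/\ prime p, p != 3 & exists x, (p %| cyc3 x)%N]} ->
  exists k, {in l, forall p, ramified p k}.
Proof.
move=> Ul lP.
have /choice[r rP] : forall p, exists k, p \in l ->
    (p %| cyc3 k)%N /\ ~~ (p ^ 2 %| cyc3 k)%N.
  move=> p; case: (boolP (p \in l)) => [pl|]; last by exists 0.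
  have [pp p3 [x px]] := lP _ pl.
  by have [k kP] := cyc3_lift pp p3 px; exists k.
have [|k kP] := @crt_seq l (fun p => p ^ 2)%N r Ul.
  move=> p q /lP[pp _ _] /lP[qp _ _] pq.
  by rewrite coprimeXl // coprimeXr // prime_coprime // dvdn_prime2.
exists k => p pl; have [pp p3 _] := lP _ pl; have [d1 d2] := rP _ pl.
have E := cyc3_mod (kP _ pl); split=> //; last by rewrite /dvdn E.
have /(congr1 (fun x => x %% p)%N) := E.
by rewrite !modn_dvdm ?dvdn_exp // /dvdn => ->.
Qed.

Local Open Scope ring_scope.

(** * Cubic residue characters *)

Section CubicLog.
Variables (q z : nat).
Hypotheses (qp : prime q) (q3 : (3 < q)%N) (qz : (q %| cyc3 z)%N).
Let w : 'F_q := z%:R.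
Let e := (q.-1 %/ 3)%N.

Let w_eq : w ^+ 2 + w + 1 = 0.
Proof.
have : ((cyc3 z)%:R : 'F_q) = 0 by apply/eqP; rewrite -(dvdn_pcharf (pchar_Fp qp)).
by rewrite /cyc3 !natrD natrX.
Qed.

Let natr_eq0 (a : nat) : ((a%:R : 'F_q) == 0) = (q %| a)%N.
Proof. by rewrite (dvdn_pcharf (pchar_Fp qp)). Qed.

Let Fp_exp (x : 'F_q) : x != 0 -> x ^+ q.-1 = 1.
Proof.
move=> x0; apply: (mulfI x0).
have := expf_card x; rewrite card_Fp // => xq.
by rewrite -exprS prednK ?prime_gt0 // xq mulr1.
Qed.

Let w_neq1 : w != 1.
Proof.
apply/eqP => w1; move: w_eq; rewrite w1 expr1n.
have -> : (1 + 1 + 1 : 'F_q) = 3%:R by ring.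
by move/eqP; rewrite natr_eq0 gtnNdvd.
Qed.

Let w_cube : w ^+ 3 = 1.
Proof.
apply/eqP; rewrite -subr_eq0.
have -> : w ^+ 3 - 1 = (w - 1) * (w ^+ 2 + w + 1) by ring.
by rewrite w_eq mulr0.
Qed.

Let w_neq0 : w != 0.
Proof.
by apply/eqP => w0; move/eqP: w_cube; rewrite w0 expr0n eq_sym oner_eq0.
Qed.

Let e3 : (e * 3)%N = q.-1.
Proof.
rewrite /e divnK //.
have := Fp_exp w_neq0; rewrite {1}(divn_eq q.-1 3) exprD mulnC exprM w_cube expr1n mul1r.
rewrite /dvdn; have := ltn_pmod q.-1 (isT : 0 < 3)%N.
case: (q.-1 %% 3)%N => [|[|[|//]]] // _.
  by rewrite expr1 => /eqP; rewrite (negPf w_neq1).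
move=> w2; have := w_cube; rewrite exprS w2 mulr1 => /eqP.
by rewrite (negPf w_neq1).
Qed.

Let cube_root1 (x : 'F_q) : x ^+ 3 = 1 -> [\/ x = 1, x = w | x = w ^+ 2].
Proof.
move=> x3; have : (x - 1) * (x - w) * (x - w ^+ 2) == 0.
  have -> : (x - 1) * (x - w) * (x - w ^+ 2) = x ^+ 3 - 1
     + (w ^+ 2 + w + 1) * (- x ^+ 2 + w * x + 1 - w) by ring.
  by rewrite w_eq x3 subrr add0r mul0r.
rewrite !mulf_eq0 !subr_eq0 -orbA.
by case/or3P => /eqP; [exact: Or31 | exact: Or32 | exact: Or33].
Qed.

(** The logarithm to the base [w], a primitive cube root of unity, of the cubic residue symbol
    x^((q-1)/3). At x = 0 the value is the meaningless 2. *)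
Definition clog (x : 'F_q) : 'F_3 :=
  if x ^+ e == 1 then 0 else if x ^+ e == w then 1 else 2%:R.

Lemma clog_cases (x : 'F_q) : x != 0 -> x ^+ e = w ^+ (clog x).
Proof.
move=> x0; rewrite /clog.
have : (x ^+ e) ^+ 3 = 1 by rewrite -exprM e3 Fp_exp.
case/cube_root1 => ->.
- by rewrite eqxx expr0.
- by rewrite (negPf w_neq1) eqxx expr1.
case: eqP => [->|_]; first by rewrite expr0.
by case: eqP => [->|_].
Qed.

Let w_exp_inj (i j : 'F_3) : w ^+ i = w ^+ j -> i = j.
Proof.
have w2 : w ^+ 2 != 1.
  apply: contra_neq w_neq1 => w2; by rewrite -w_cube exprS w2 mulr1.
have w12 : w != w ^+ 2.
  apply: contra_neq w_neq1 => E; apply: (mulfI w_neq0).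
  by rewrite mulr1 -expr2 -E.
case: i j => [[|[|[|i]]] //= hi] [[|[|[|j]]] //= hj] /eqP E; apply/val_inj => //=;
  move: E; rewrite ?expr0 ?expr1 ?(negPf w_neq1) ?(negPf w2) ?(negPf w12) //;
  by rewrite eq_sym ?(negPf w_neq1) ?(negPf w2) ?(negPf w12).
Qed.

Lemma clogM (x y : 'F_q) : x != 0 -> y != 0 ->
  clog (x * y) = clog x + clog y.
Proof.
move=> x0 y0; apply: w_exp_inj.
rewrite -clog_cases ?mulf_neq0 // exprMn !clog_cases // -exprD /=.
rewrite {1}(divn_eq (clog x + clog y) 3) exprD mulnC exprM w_cube expr1n mul1r.
by [].
Qed.

Lemma clog_cube (c : 'F_q) : c != 0 -> clog (c ^+ 3) = 0.
Proof.
by move=> c0; rewrite /clog -exprM mulnC e3 Fp_exp // eqxx.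
Qed.

(** With P = X^2 + X + 1, the polynomial P (P^e - 1) has degree 2 e + 2, less than q = 3 e + 1, so
    it cannot vanish on all of F_q. *)
Lemma exists_cyc3_noncube :
  exists x : nat, ~~ (q %| cyc3 x)%N /\ clog (cyc3 x)%:R != 0.
Proof.
pose P : {poly 'F_q} := 'X ^+ 2 + 'X + 1.
pose Q := P * (P ^+ e - 1).
have szP : size P = 3%N.
  by rewrite /P -addrA size_polyDl ?size_polyXn // size_XaddC.
have e0 : (0 < e)%N by rewrite /e divn_gt0 // -ltnS prednK ?prime_gt0.
have P0 : P != 0 by rewrite -size_poly_gt0 szP.
have szPe : size (P ^+ e) = (2 * e).+1.
  by rewrite -[X in (X * e)%N]/(3.-1) -szP -size_exp prednK // size_poly_gt0 expf_neq0.
have szPe1 : size (P ^+ e - 1) = (2 * e).+1.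
  by rewrite size_polyDl szPe // size_polyN size_poly1; lia.
have Q0 : Q != 0 by rewrite mulf_neq0 // -size_poly_gt0 szPe1.
have szQ : size Q = (2 * e + 3)%N.
  by rewrite size_mul // -?size_poly_gt0 ?szPe1 // szP; lia.
have [x Qx] : exists x, ~~ root Q x.
  apply/existsP; rewrite -negb_forall; apply/negP => /forallP allQ.
  have /= := @max_poly_roots _ Q (enum 'F_q) Q0.
  rewrite szQ -cardE card_Fp // => /(_ _ (enum_uniq _)).
  have -> : all (root Q) (enum 'F_q) by apply/allP => x _; exact: allQ.
  (* The degree count fails only for e = 1, which would mean q = 4. *)
  have q4 : q != 4 by apply: contraTneq qp => ->.
  by move=> /(_ isT); have := e3; lia.
have Px : P.[x] = (cyc3 (x : nat))%:R.
  rewrite /P /cyc3 !hornerE !natrD natrX.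
  have -> : ((x : nat)%:R : 'F_q) = x; last by [].
  by rewrite Zp_nat valZpK.
have Qx0 : Q.[x] = P.[x] * (P.[x] ^+ e - 1) by rewrite /Q !hornerE.
move: Qx; rewrite rootE Qx0 Px mulf_eq0 negb_or natr_eq0 => /andP[x1 x2].
exists x; split=> //; apply: contraNneq x2 => cl0.
by rewrite clog_cases ?natr_eq0 // cl0 expr0 subrr.
Qed.

End CubicLog.

(* A cubic residue character modulo q, written additively. *)
Lemma exists_cubic_log (q z : nat) : prime q -> (3 < q)%N -> (q %| cyc3 z)%N ->
  exists chi : nat -> 'F_3,
  [/\ forall a b, ~~ (q %| a)%N -> ~~ (q %| b)%N -> chi (a * b)%N = chi a + chi b,
      forall a b, a = b %[mod q] -> chi a = chi b,
      forall (a : nat) (c : int), ~~ (q %| a)%N -> (q%:Z %| c ^+ 3 - a%:Z)%Z ->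
        chi a = 0
    & exists x, ~~ (q %| cyc3 x)%N /\ chi (cyc3 x) != 0].
Proof.
move=> qp q3 qz.
have nz a : ((a%:R : 'F_q) == 0) = (q %| a)%N by rewrite (dvdn_pcharf (pchar_Fp qp)).
have nzz (a : int) : (q%:Z %| a)%Z -> (a%:~R : 'F_q) = 0.
  case/dvdzP => b ->; rewrite intrM.
  have -> : (q%:Z)%:~R = q%:R :> 'F_q by [].
  by rewrite -[q%:R]/(q%:R : 'F_q) pchar_Fp_0 // mulr0.
exists (fun a => clog z (a%:R : 'F_q)); split.
- by move=> a b qa qb; rewrite natrM clogM ?nz.
- by move=> a b ab; congr clog; apply/val_inj; rewrite /= !val_Fp_nat.
- move=> a c qa /nzz; rewrite rmorphB rmorphXn /= => /eqP; rewrite subr_eq0 => /eqP cE.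
  have -> : (a%:R : 'F_q) = (c%:~R) ^+ 3 by rewrite cE.
  apply: clog_cube => //; apply: contraNneq qa => c0.
  by rewrite -nz -[a%:R]/((a%:Z)%:~R) -cE c0 expr0n.
exact: exists_cyc3_noncube.
Qed.

(** * Primes separated by cubic residue symbols *)

(** As p p'^2 is p / p' times a cube, this says that p and p' have different cubic symbols at q. *)
Definition cube_separated (p p' q : nat) : Prop :=
  [/\ q != p, q != p' & forall c : int, ~~ (q%:Z %| c ^+ 3 - (p * p' ^ 2)%N%:Z)%Z].

Lemma exists_primes_seq (t B : nat) : exists qs : seq nat,
  [/\ size qs = t, uniq qs &
   {in qs, forall q, [/\ prime q, (B < q)%N & exists z, (q %| cyc3 z)%N]}].
Proof.
elim: t => [|t [qs [sz Uq qP]]]; first by exists [::].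
have [q [z [qp qB qz]]] := cyc3_prime_gt (maxn B (\max_(p <- qs) p)).
move: qB; rewrite gtn_max => /andP[qB qM].
have qNqs : q \notin qs.
  apply: contraTN qM => qqs; rewrite -leqNgt.
  exact: (@leq_bigmax_seq _ qs xpredT id q).
exists (q :: qs); split=> [||p] /=; rewrite ?sz ?qNqs //.
by rewrite inE => /orP[/eqP->|/qP //]; split=> //; exists z.
Qed.

Lemma row_free_neq (F : fieldType) (m n : nat) (A : 'M[F]_(m, n)) (i j : 'I_m) :
  row_free A -> i != j -> row i A != row j A.
Proof.
move=> /row_freeP[C AC] ij; apply/eqP => E.
have : row i (1%:M : 'M[F]_m) = row j 1%:M by rewrite -AC !row_mul E.
move/rowP/(_ i); rewrite !mxE eqxx eq_sym (negPf ij) => /eqP.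
by rewrite oner_eq0.
Qed.

(* Each row of the diagonal matrix of the residue symbols of the cyc3 (x i) is *)
(* a combination of rows indexed by primes, so at least t of the latter are    *)
(* linearly independent, hence pairwise distinct.                              *)
Lemma exists_config (t B : nat) : exists k ps,
  [/\ size ps = t.+1, uniq ps, {in ps, forall p, ramified p k},
      {in ps &, forall p p', p != p' -> exists q, ramified q k /\ cube_separated p p' q}
    & exists r, (B < r)%N /\ ramified r k].
Proof.
have [qs [sz Uq qP]] := exists_primes_seq t.+1 (maxn B 3).
have q3 q : q \in qs -> (3 < q)%N by move=> /qP[_ + _]; rewrite gtn_max => /andP[].
have /choice[chi chiP] : forall q, exists chi : nat -> 'F_3, q \in qs ->
  [/\ forall a b, ~~ (q %| a)%N -> ~~ (q %| b)%N -> chi (a * b)%N = chi a + chi b,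
      forall a b, a = b %[mod q] -> chi a = chi b,
      forall (a : nat) (c : int), ~~ (q %| a)%N -> (q%:Z %| c ^+ 3 - a%:Z)%Z ->
        chi a = 0
    & exists x, ~~ (q %| cyc3 x)%N /\ chi (cyc3 x) != 0].
  move=> q; case: (boolP (q \in qs)) => [qq|]; last by exists (fun=> 0).
  have [qp _ [z qz]] := qP _ qq.
  by have [chi chiP] := exists_cubic_log qp (q3 _ qq) qz; exists chi.
have /choice[X XP] : forall q, exists x, q \in qs ->
    ~~ (q %| cyc3 x)%N /\ chi q (cyc3 x) != 0.
  move=> q; case: (boolP (q \in qs)) => [qq|]; last by exists 0%N.
  by have [_ _ _ [x xP]] := chiP _ qq; exists x.
have qpr q : q \in qs -> prime q by case/qP.
(* Vanishing modulo the other q' makes x^2 + x + 1 equal to 1 there, so its symbol is trivial;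
   vanishing modulo 3 keeps 3 out of its prime factors. *)
have /choice[x xP] : forall q, exists x : nat, q \in qs ->
    [/\ x = X q %[mod q], x = 0 %[mod 3] &
    {in qs, forall q', q' != q -> x = 0 %[mod q']}].
  move=> q; case: (boolP (q \in qs)) => [qq|]; last by exists 0%N.
  have [||x xP] := @crt_seq (3%N :: qs) id (fun p => if p == q then X q else 0%N).
  - by rewrite /= Uq andbT; apply/negP => /q3.
  - have pr p : p \in 3%N :: qs -> prime p.
      by rewrite inE => /orP[/eqP->|/qpr].
    by move=> p p' /pr pp /pr p'p ne; rewrite prime_coprime // dvdn_prime2.
  exists x => _; split.
  - by have := xP q; rewrite inE qq orbT eqxx; apply.
  - have := xP 3%N (mem_head _ _); case: eqP => // E.
    by have := q3 _ qq; rewrite -E.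
  - by move=> q' qq' ne; have := xP q'; rewrite inE qq' orbT (negPf ne); apply.
pose m q := cyc3 (x q).
have mq q q' : q \in qs -> q' \in qs -> ~~ (q' %| m q)%N.
  move=> qq qq'; have [x1 _ x2] := xP _ qq; case: (eqVneq q' q) => [->|ne].
    have [+ _] := XP _ qq.
    by rewrite /dvdn /m (cyc3_mod x1).
  by rewrite /dvdn /m (cyc3_mod (x2 _ qq' ne)) modn_small // (ltn_trans _ (q3 _ qq')).
have m3 q : q \in qs -> ~~ (3 %| m q)%N.
  by move=> qq; have [_ x1 _] := xP _ qq; rewrite /dvdn /m (cyc3_mod x1).
have m_gt0 q : (0 < m q)%N by rewrite /m /cyc3 addn1.
pose S := primes (\prod_(q <- qs) m q).
have US : uniq S by exact: primes_uniq.
have SP p : p \in S -> prime p /\ exists2 q, q \in qs & (p %| m q)%N.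
  rewrite mem_primes => /and3P[pp _]; rewrite Euclid_dvd_prod // big_has.
  by case/hasP=> q qq pq; split=> //; exists q.
have qNS q : q \in qs -> q \notin S.
  by move=> qq; apply/negP => /SP[_ [q' qq' d]]; case/negP: (mq _ _ qq' qq).
pose Q (j : 'I_t.+1) := nth 0%N qs j.
have Qq j : Q j \in qs by rewrite mem_nth // sz.
pose v (a : nat) : 'rV['F_3]_t.+1 := \row_j chi (Q j) a.
pose M := \matrix_(i < size S, j < t.+1) chi (Q j) (nth 0%N S i).
have vS p : p \in S -> (v p <= M)%MS.
  move=> pS; have iS : (index p S < size S)%N by rewrite index_mem.
  have -> : v p = row (Ordinal iS) M by apply/rowP => j; rewrite !mxE nth_index.
  exact: row_sub.
(* Symbols turn products into sums: split off the least prime factor and induct. *)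
have vM a : (0 < a)%N -> {subset primes a <= S} -> (v a <= M)%MS.
  elim/ltn_ind: a => a IH a0 aS.
  have qa (j : 'I_t.+1) : ~~ (Q j %| a)%N.
    apply/negP => d; have /negP := qNS _ (Qq j); apply; apply: aS.
    by rewrite mem_primes qpr ?a0 ?d.
  case: (ltnP 1 a) => [a1|a1]; last first.
    have -> : a = 1%N by lia.
    suff -> : v 1%N = 0 by exact: sub0mx.
    apply/rowP => j; rewrite !mxE; have [cM _ _ _] := chiP _ (Qq j).
    have q1 : ~~ (Q j %| 1)%N by rewrite dvdn1 neq_ltn orbC (ltn_trans _ (q3 _ (Qq j))).
    by apply: (addrI (chi (Q j) 1%N)); rewrite addr0 -cM.
  have pS : pdiv a \in S by rewrite aS // pi_pdiv.
  have aE := divnK (pdiv_dvd a); set b := (a %/ pdiv a)%N in aE.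
  have b0 : (0 < b)%N by rewrite divn_gt0 ?pdiv_gt0 // dvdn_leq ?pdiv_dvd.
  have -> : v a = v b + v (pdiv a).
    apply/rowP => j; rewrite !mxE; have [cM _ _ _] := chiP _ (Qq j).
    have := qa j; rewrite -{1 2}aE Euclid_dvdM ?qpr // negb_or => /andP[? ?].
    by rewrite cM.
  apply: addmx_sub (vS _ pS); apply: IH => //.
    by rewrite ltn_Pdiv ?pdiv_prime // prime_gt1 ?pdiv_prime.
  move=> p; rewrite mem_primes => /and3P[pp _ pb]; apply: aS.
  by rewrite mem_primes pp a0 -aE dvdn_mulr.
have rM : \rank M = t.+1.
  apply/eqP; rewrite eqn_leq rank_leq_col /=.
  pose D : 'M['F_3]_t.+1 := \matrix_(i, j) chi (Q j) (m (Q i)).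
  have DM : (D <= M)%MS.
    apply/row_subP => i.
    have -> : row i D = v (m (Q i)) by apply/rowP => j; rewrite !mxE.
    apply: vM => // p; rewrite !mem_primes => /and3P[pp _ pm].
    rewrite pp Euclid_dvd_prod // big_has prodn_gt0 //=.
    by apply/hasP; exists (Q i).
  have Dd : D = diag_mx (\row_j chi (Q j) (m (Q j))).
    apply/matrixP => i j; rewrite !mxE; case: (eqVneq i j) => [->|ij] //.
    rewrite mulr0n; have [_ cmod ccube _] := chiP _ (Qq j).
    have [_ _ x2] := xP _ (Qq i).
    have E : m (Q i) = 1 %[mod Q j].
      rewrite /m (cyc3_mod (x2 _ (Qq j) _)) //.
      by rewrite /Q nth_uniq ?sz // eq_sym.
    rewrite (cmod _ _ E); apply: (ccube _ 1).
      by rewrite dvdn1 neq_ltn orbC (ltn_trans _ (q3 _ (Qq j))).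
    by rewrite expr1n subrr dvdz0.
  apply: leq_trans (mxrankS DM); rewrite Dd.
  suff : diag_mx (\row_j chi (Q j) (m (Q j))) \in unitmx by move/mxrank_unit->.
  rewrite unitmxE det_diag unitfE; apply/prodf_neq0 => j _; rewrite mxE.
  have [x1 _ _] := xP _ (Qq j); have [_ cmod _ _] := chiP _ (Qq j).
  by rewrite (cmod _ _ (cyc3_mod x1)); case: (XP _ (Qq j)).
pose f := maxrankfun M.
have [k kP] : exists k, {in undup (qs ++ S), forall p, ramified p k}.
  apply: exists_ramified; first exact: undup_uniq.
  move=> p; rewrite mem_undup mem_cat => /orP[pq|pS].
    have [pp _ pz] := qP _ pq; split=> //.
    by rewrite neq_ltn q3 ?orbT.
  have [pp [q qq pm]] := SP _ pS; split=> //; last by exists (x q).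
  by apply: contraTneq pm => ->; exact: m3.
have kq q : q \in qs -> ramified q k by move=> qq; apply: kP; rewrite mem_undup mem_cat qq.
have kS p : p \in S -> ramified p k.
  by move=> pS; apply: kP; rewrite mem_undup mem_cat pS orbT.
exists k, [seq nth 0%N S (f i) | i : 'I_(\rank M)]; split.
- by rewrite size_map -cardE card_ord rM.
- rewrite map_inj_uniq ?enum_uniq // => i j /eqP.
  by rewrite nth_uniq // => /eqP /val_inj /maxrankfun_inj.
- by move=> _ /mapP[i _ ->]; apply: kS; exact: mem_nth.
- move=> _ _ /mapP[i _ ->] /mapP[i' _ ->].
  set p := nth _ _ _; set p' := nth _ _ _ => pp'.
  have pS : p \in S by exact: mem_nth.
  have p'S : p' \in S by exact: mem_nth.
  have ne : row (f i) M != row (f i') M.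
    have := @row_free_neq _ _ _ _ i i' (maxrowsub_free M).
    rewrite !row_rowsub; apply; by apply: contra_neq pp' => ii; rewrite /p /p' ii.
  have [j jP] : exists j, chi (Q j) p != chi (Q j) p'.
    apply/existsP; rewrite -negb_forall; apply: contraNN ne => /forallP E.
    by apply/eqP/rowP => j; rewrite !mxE; apply/eqP; exact: E.
  have Qn r : r \in S -> Q j != r.
    by move=> rS; apply: contraTneq rS => <-; exact: qNS.
  have Qd r : r \in S -> ~~ (Q j %| r)%N.
    by move=> rS; have [rp _] := SP _ rS; rewrite dvdn_prime2 ?(qpr _ (Qq j)) //; exact: Qn.
  exists (Q j); split; first exact: kq.
  split; [exact: Qn | exact: Qn | move=> c; apply/negP => dc].
  have [cM _ ccube _] := chiP _ (Qq j).
  case/negP: jP; rewrite -subr_eq0.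
  have d2 : ~~ (Q j %| p' ^ 2)%N by rewrite Euclid_dvdX ?(qpr _ (Qq j)) //= andbT Qd.
  have := ccube _ _ _ dc; rewrite Euclid_dvdM ?(qpr _ (Qq j)) // negb_or d2 Qd // => /(_ isT).
  rewrite (cM _ _ (Qd _ pS) d2) -mulnn (cM _ _ (Qd _ p'S) (Qd _ p'S)).
  move=> <-; apply/eqP.
  (* In F_3 one has 2 = -1, so the symbol of p p'^2 is chi p - chi p'. *)
  have three (a : 'F_3) : a + a = - a.
    by apply/eqP; rewrite -subr_eq0 opprK; case: a => [[|[|[|]]] //].
  by rewrite three.
have Qt := Qq ord0; exists (Q ord0); split; last exact: kq.
by have [_ + _] := qP _ Qt; rewrite gtn_max => /andP[].
Qed.

(** * Ideals of the ring of integers *)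

Lemma integral_rat_int (r : rat) :
  integralOver (intr : int -> rat) r -> exists t : int, r = t%:~R.
Proof.
move=> [q qm qr]; have : (ratr r : algC) \in Num.int.
  apply: Cint_rat_Aint; first exact: Crat_rat.
  apply: (@root_monic_Aint (map_poly intr q)).
  - have -> : map_poly intr q = map_poly ratr (map_poly intr q) :> {poly algC}.
      by rewrite -map_poly_comp; apply: eq_map_poly => c /=; rewrite ratr_int.
    by rewrite fmorph_root.
  - by rewrite monic_map.
  - by apply/polyOverP => i; rewrite coef_map /= intr_int.
by move/intrP => [t]; rewrite -(ratr_int algC) => /fmorph_inj rt; exists t.
Qed.

Section Integers.
Variable L : fieldExtType rat.
Local Notation O := (@ring_of_integers L).

Lemma OK_int (m : int) : O m%:~R. Proof. exact: integral_id. Qed.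
Lemma OK_add (x y : L) : O x -> O y -> O (x + y). Proof. exact: integral_add. Qed.
Lemma OK_opp (x : L) : O x -> O (- x). Proof. exact: integral_opp. Qed.
Lemma OK_sub (x y : L) : O x -> O y -> O (x - y). Proof. exact: integral_sub. Qed.
Lemma OK_mul (x y : L) : O x -> O y -> O (x * y). Proof. exact: integral_mul. Qed.
Lemma OK_exp (x : L) (n : nat) : O x -> O (x ^+ n).
Proof.
by move=> Ox; elim: n => [|n IH]; [exact: (OK_int 1) | rewrite exprS; exact: OK_mul].
Qed.

Lemma OK_morph (M : fieldExtType rat) (f : {rmorphism M -> L}) (x : M) :
  ring_of_integers x <-> O (f x).
Proof.
have E (q : {poly int}) : map_poly intr q = map_poly f (map_poly intr q) :> {poly L}.
  by rewrite -map_poly_comp; apply: eq_map_poly => m /=; rewrite rmorph_int.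
split=> -[q qm qx]; exists q => //.
  by rewrite E fmorph_root.
by move: qx; rewrite E fmorph_root.
Qed.

Lemma intr_fext_eq0 (m : int) : (m%:~R == 0 :> L) = (m == 0).
Proof. by rewrite -(rmorph_int (in_alg L)) fmorph_eq0 intr_eq0. Qed.

Lemma intr_fext_inj : injective (intr : int -> L).
Proof.
move=> a b /eqP; rewrite -subr_eq0 -rmorphB /= intr_fext_eq0 subr_eq0.
by move/eqP.
Qed.

Lemma OK_rational (x : L) (e m : int) :
  O x -> e != 0 -> e%:~R * x = m%:~R -> exists t : int, x = t%:~R.
Proof.
move=> Ox e0 ex.
have xE : x = in_alg L (m%:~R / e%:~R).
  apply: (mulfI (_ : e%:~R != 0 :> L)); first by rewrite intr_fext_eq0.
  rewrite ex -(rmorph_int (in_alg L) e) -rmorphM mulrCA divff ?intr_eq0 // mulr1.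
  by rewrite rmorph_int.
set r := _ / _ in xE; have [|t rt] := @integral_rat_int r.
  move: Ox; rewrite xE => -[q qm].
  have -> : map_poly intr q = map_poly (in_alg L) (map_poly intr q) :> {poly L}.
    rewrite -map_poly_comp; apply: eq_map_poly => b.
    by rewrite -[RHS]/(in_alg L b%:~R) rmorph_int.
  by rewrite fmorph_root; exists q.
by exists t; rewrite xE rt rmorph_int.
Qed.

End Integers.

(** The norm of u + v y + w y^2 when y, z and - y - z are the roots of T^3 - D T + G. *)
Lemma cubic_norm_identity (R : comNzRingType) (y z : R) (D G u v w : int) :
  D%:~R = y ^+ 2 + y * z + z ^+ 2 -> G%:~R = y * z * (y + z) ->
  (u%:~R + v%:~R * y + w%:~R * y ^+ 2) * (u%:~R + v%:~R * z + w%:~R * z ^+ 2) *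
  (u%:~R + v%:~R * (- y - z) + w%:~R * (- y - z) ^+ 2) =
  (u ^+ 3 + 2 * D * u ^+ 2 * w - D * u * v ^+ 2 + 3 * G * u * v * w
   + D ^+ 2 * u * w ^+ 2 - G * v ^+ 3 + D * G * v * w ^+ 2 + G ^+ 2 * w ^+ 3)%:~R.
Proof.
move=> DE GE.
transitivity (u%:~R ^+ 3 + 2 * D%:~R * u%:~R ^+ 2 * w%:~R - D%:~R * u%:~R * v%:~R ^+ 2
   + 3 * G%:~R * u%:~R * v%:~R * w%:~R + D%:~R ^+ 2 * u%:~R * w%:~R ^+ 2
   - G%:~R * v%:~R ^+ 3 + D%:~R * G%:~R * v%:~R * w%:~R ^+ 2
   + G%:~R ^+ 2 * w%:~R ^+ 3 : R); last by ring.
by rewrite DE GE; ring.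
Qed.

Section Ideals.
Local Open Scope classical_set_scope.
Variable L : fieldExtType rat.
Local Notation O := (@ring_of_integers L).
Variable I : set L.
Hypothesis subI : OK_submodule I.

Lemma OK_submoduleN (x : L) : I x -> I (- x).
Proof.
by case: subI => _ _ IM Ix; rewrite -mulN1r; apply: IM => //; exact: (OK_int L (-1)).
Qed.

Lemma OK_submoduleB (x y : L) : I x -> I y -> I (x - y).
Proof. by case: subI => _ ID _ Ix Iy; apply: ID => //; exact: OK_submoduleN. Qed.

Lemma OK_submodule_sum (T : eqType) (r : seq T) (F : T -> L) :
  (forall i, i \in r -> I (F i)) -> I (\sum_(i <- r) F i).
Proof.
case: subI => I0 ID _ IF; rewrite big_seq.
by elim/big_ind: _ => // x y Ix Iy; exact: ID.
Qed.

(** By Bezout; this removes a denominator e prime to p when working modulo an ideal that contains p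
    x. *)
Lemma OK_submodule_coprime (p e : int) (x : L) :
  coprimez p e -> I (p%:~R * x) -> I (e%:~R * x) -> I x.
Proof.
case: subI => _ ID IM /eqP co Ip Ie; have [a [b]] := Bezoutz p e; rewrite co => ab.
have -> : x = a%:~R * (p%:~R * x) + b%:~R * (e%:~R * x).
  by rewrite !mulrA -mulrDl -!rmorphM -rmorphD /= ab mul1r.
by apply: ID; apply: IM => //; exact: OK_int.
Qed.

Let coset (x : L) : set L := [set x + z | z in I].

Lemma coset_id (x : L) : coset x x.
Proof. by case: subI => I0 _ _; exists 0; rewrite ?addr0. Qed.

Lemma cosetP (x y : L) : coset x y <-> I (y - x).
Proof.
split=> [[z Iz <-]|Iyx]; first by rewrite addrC addKr.
by exists (y - x); rewrite // addrC subrK.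
Qed.

Lemma coset_eq (x y : L) : coset x = coset y <-> I (x - y).
Proof.
split=> [E|Ixy]; first by apply/cosetP; rewrite -E; exact: coset_id.
case: subI => _ ID _; apply/seteqP; split=> z /cosetP Iz; apply/cosetP.
  by rewrite -(subrK x z) -addrA; apply: ID.
by rewrite -[z](subrK y) -addrA; apply: ID => //; rewrite -opprB; exact: OK_submoduleN.
Qed.

Lemma ideal_norm_residues (p : nat) : (0 < p)%N ->
  (forall x, O x -> exists c : int, I (x - c%:~R)) ->
  (forall c : int, I c%:~R <-> (p%:Z %| c)%Z) -> ideal_norm I = p.
Proof.
move=> p0 res Iint; pose f (i : 'I_p) := coset (i : nat)%:R.
have fE : ideal_cosets I = [set` [fset C in map f (enum 'I_p)]%fset].
  apply/seteqP; split=> C /=.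
    move=> [x Ox <-]; have [c Ic] := res _ Ox.
    have cp : (`|(c %% p%:Z)%Z|%N < p)%N.
      by rewrite -ltz_nat gez0_abs ?modz_ge0 ?ltz_pmod // -lt0n.
    rewrite inE; apply/mapP; exists (Ordinal cp); first by rewrite mem_enum.
    apply/coset_eq; rewrite /= -[_%:R]/(_%:Z%:~R) gez0_abs ?modz_ge0 -?lt0n //.
    case: subI => _ ID _; rewrite -(subrK c%:~R x) -addrA; apply: ID => //.
    rewrite -rmorphB; apply/Iint; rewrite {1}(divz_eq c p%:Z) addrK.
    exact: dvdz_mull.
  rewrite inE => /mapP[i _ ->]; exists (i : nat)%:R => //.
  exact: (OK_int L (i : nat)%:Z).
rewrite /ideal_norm fE set_fsetK card_fseq undup_id.
  by rewrite size_map -cardE card_ord.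
rewrite map_inj_uniq ?enum_uniq // => i j /coset_eq.
rewrite -[_%:R]/(_%:Z%:~R) -[(j : nat)%:R]/(_%:Z%:~R) -rmorphB => /Iint.
rewrite -eqz_mod_dvd !modz_nat eqz_nat !modn_small // => /eqP E.
exact: val_inj.
Qed.

(* Lagrange for O / I: translating by 1 permutes the cosets, so compare the *)
(* sums of representatives before and after.                                *)
Lemma ideal_norm_mem (p : nat) : (0 < p)%N -> ideal_norm I = p -> I p%:R.
Proof.
move=> p0 Ip; set F := fset_set (ideal_cosets I).
have cF : #|` F|%fset = p by [].
(* On an infinite set [fset_set] is empty, so a positive norm forces finiteness. *)
have fin : finite_set (ideal_cosets I).
  case: (pselect (finite_set (ideal_cosets I))) => // nf.
  by move: p0; rewrite -cF /F /fset_set; case: pselect.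
have FP C : C \in F <-> exists2 x, O x & coset x = C.
  by rewrite in_fset_set // inE.
have /choice[r rP] : forall C : set L, exists x, C \in F -> O x /\ coset x = C.
  move=> C; case: (boolP (C \in F)) => [/FP[x Ox xC]|_]; first by exists x.
  by exists 0.
pose T (C : set L) : set L := coset (r C + 1).
have TF C : C \in F -> T C \in F.
  move=> /rP[Or _]; apply/FP; exists (r C + 1) => //.
  by apply: OK_add => //; exact: (OK_int L 1).
have Tinj : {in F &, injective T}.
  move=> C D CF DF /coset_eq; rewrite opprD addrACA subrr addr0 => /coset_eq.
  by have [_ ->] := rP _ CF; have [_ ->] := rP _ DF.
have UF : uniq (enum_fset F) by exact: fset_uniq.
have UT : uniq (map T (enum_fset F)) by rewrite map_inj_in_uniq.
have pT : perm_eq (map T (enum_fset F)) (enum_fset F).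
  apply: uniq_perm => //.
  have sT : {subset map T (enum_fset F) <= enum_fset F}.
    by move=> _ /mapP[C CF ->]; exact: TF.
  by case: (uniq_min_size UT sT); rewrite ?size_map.
have sumE : \sum_(C <- enum_fset F) r (T C) = \sum_(C <- enum_fset F) r C.
  by rewrite -[RHS](perm_big _ pT) big_map.
have -> : p%:R = \sum_(C <- enum_fset F) (r C + 1 - r (T C)) :> L.
  rewrite sumrB big_split /= sumE addrAC subrr add0r.
  by rewrite big_const_seq count_predT iter_addr_0 cF.
apply: OK_submodule_sum => C CF; apply/coset_eq.
by have [_ ->] := rP _ (TF _ CF).
Qed.

End Ideals.

Lemma Euclid_dvdzM (p : nat) (a b : int) : prime p ->
  (p%:Z %| a * b)%Z = (p%:Z %| a)%Z || (p%:Z %| b)%Z.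
Proof. by move=> pp; rewrite !dvdzE abszM Euclid_dvdM. Qed.

Lemma Euclid_dvdzX (p n : nat) (a : int) : prime p -> (0 < n)%N ->
  (p%:Z %| a ^+ n)%Z = (p%:Z %| a)%Z.
Proof. by move=> pp n0; rewrite !dvdzE abszX Euclid_dvdX // n0 andbT. Qed.

(** * The norm of the cyclic cubic field *)

Section Cubic.
Variables (L : fieldExtType rat) (k : nat) (y : L) (s : {rmorphism L -> L}).
Local Notation O := (@ring_of_integers L).
Let d : int := k%:Z ^+ 2 + k%:Z + 1.
Let c : int := 2 * k%:Z + 1.
Let g : int := c * d.
Let lin (u v w : int) : L := u%:~R + v%:~R * y + w%:~R * y ^+ 2.

Hypothesis y3 : y ^+ 3 = (3 * d)%:~R * y - g%:~R.
Hypothesis sy : s y = y ^+ 2 + k%:~R * y - (2 * d)%:~R.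
Hypothesis gen : forall x : L, exists e u v w : int, e != 0 /\ e%:~R * x = lin u v w.

Let K : L := k%:~R.
Let rel : L := y ^+ 3 - 3 * (K ^+ 2 + K + 1) * y + (2 * K + 1) * (K ^+ 2 + K + 1).

Let rel0 : rel = 0.
Proof.
by rewrite /rel y3 /g /c /d /K; ring.
Qed.

Let y1 := y ^+ 2 + K * y - 2 * (K ^+ 2 + K + 1).

Let syE : s y = y1. Proof. by rewrite sy /y1 /d /K; ring. Qed.

Let y1_eq : y ^+ 2 + y * y1 + y1 ^+ 2 = (3 * d)%:~R.
Proof.
have -> : (3 * d)%:~R = 3 * (K ^+ 2 + K + 1) :> L by rewrite /d /K; ring.
apply/eqP; rewrite -subr_eq0; apply/eqP.
(* The cofactor of [rel] is the quotient in the division by the cubic of [y]. *)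
have -> : y ^+ 2 + y * y1 + y1 ^+ 2 - 3 * (K ^+ 2 + K + 1) = (y + (2 * K + 1)) * rel.
  by rewrite /rel /y1; ring.
by rewrite rel0 mulr0.
Qed.

Let ssy : s (s y) = - y - y1.
Proof.
have -> : s (s y) = y1 ^+ 2 + K * y1 - 2 * (K ^+ 2 + K + 1).
  rewrite {1}sy rmorphB rmorphD rmorphXn rmorphM !rmorph_int syE /d /K.
  by ring.
apply/eqP; rewrite -subr_eq0; apply/eqP.
rewrite -[RHS](mulr0 (y + 2 * K)) -rel0 /rel /y1.
ring.
Qed.

(** The field norm, as the product of the conjugates under the generator [s] of the Galois group. *)
Definition cnorm (x : L) : L := x * s x * s (s x).

Definition norm_form (u v w : int) : int :=
  u ^+ 3 + 6 * d * u ^+ 2 * w - 3 * d * u * v ^+ 2 + 3 * g * u * v * w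
  + 9 * d ^+ 2 * u * w ^+ 2 - g * v ^+ 3 + 3 * d * g * v * w ^+ 2 + g ^+ 2 * w ^+ 3.

Lemma cnorm_lin (u v w : int) : cnorm (lin u v w) = (norm_form u v w)%:~R.
Proof.
have gE : g%:~R = y * y1 * (y + y1) :> L.
  have -> : y * y1 * (y + y1) = y * (y ^+ 2 + y * y1 + y1 ^+ 2) - y ^+ 3 by ring.
  by rewrite y1_eq y3; ring.
have dE : (3 * d)%:~R = y ^+ 2 + y * y1 + y1 ^+ 2 :> L by rewrite y1_eq.
have E1 : s (lin u v w) = u%:~R + v%:~R * y1 + w%:~R * y1 ^+ 2.
  by rewrite /lin !(rmorphD, rmorphM, rmorphXn, rmorph_int) syE.
have E2 : s (s (lin u v w)) = u%:~R + v%:~R * (- y - y1) + w%:~R * (- y - y1) ^+ 2.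
  by rewrite /lin !(rmorphD, rmorphM, rmorphXn, rmorph_int) ssy.
rewrite /cnorm E2 E1 /lin (cubic_norm_identity u v w dE gE) /norm_form.
by apply: (congr1 (intr : int -> L)); ring.
Qed.

Lemma cnormM (a b : L) : cnorm (a * b) = cnorm a * cnorm b.
Proof. by rewrite /cnorm !rmorphM; ring. Qed.

Lemma cnorm1 : cnorm 1 = 1.
Proof. by rewrite /cnorm !rmorph1 !mulr1. Qed.

Lemma cnorm_int (m : int) : cnorm m%:~R = (m ^+ 3)%:~R.
Proof. by rewrite /cnorm !rmorph_int; ring. Qed.

(** The norm is integral as a product of conjugates, and rational because a multiple of x has
    rational integer coordinates. *)
Lemma cnorm_OK (x : L) : O x -> exists t : int, cnorm x = t%:~R.
Proof.
move=> Ox; have [e [u [v [w [e0 E]]]]] := gen x.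
apply: (@OK_rational _ _ (e ^+ 3) (norm_form u v w)).
- have Os z : O z -> O (s z) by move/(OK_morph s).
  by have O1 := Os _ Ox; exact: OK_mul (OK_mul Ox O1) (Os _ O1).
- by rewrite expf_neq0.
- by rewrite -cnorm_int -cnormM E cnorm_lin.
Qed.

Lemma OK_y : O y.
Proof.
pose q : {poly int} := 'X ^+ 3 - (3 * d) *: 'X + g%:P.
exists q.
  rewrite monicE /q -addrA addrC lead_coefDr ?lead_coefXn //.
  rewrite size_polyXn (leq_ltn_trans (size_polyD _ _)) // gtn_max size_polyN.
  rewrite (leq_ltn_trans (size_scale_leq _ _)) ?size_polyX //.
  by rewrite (leq_ltn_trans (size_polyC_leq1 _)).
rewrite /q rmorphD rmorphB /= map_polyXn map_polyZ map_polyX map_polyC /=.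
by rewrite rootE !hornerE /= y3; apply/eqP; ring.
Qed.

(** * The prime above a totally ramified p *)

Section Ramified.
Local Open Scope classical_set_scope.
Variable p : nat.
Hypothesis pk : ramified p k.
Let pp : prime p. Proof. by case: pk. Qed.
Local Notation P := (p%:Z).

Let P0 : P != 0. Proof. by rewrite -lt0n prime_gt0. Qed.

Let dE : d = (cyc3 k)%:Z. Proof. by rewrite /d /cyc3; lia. Qed.

(** The Eisenstein condition on the constant term: p does not divide c, because 4 d - c^2 = 3. *)
Let gE : exists2 g' : int, g = P * g' & ~~ (P %| g')%Z.
Proof.
have [_ p3 /dvdnP[d' d'E] p2] := pk.
have nd' : ~~ (p %| d')%N.
  by apply: contra p2; rewrite d'E -mulnn dvdn_pmul2r ?prime_gt0.
exists (c * d'%:Z); first by rewrite /g dE d'E; ring.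
rewrite Euclid_dvdzM // negb_or nd' andbT; apply/negP => pc.
have : (P %| 4 * d - c ^+ 2)%Z.
  by rewrite rpredB // ?dvdz_mull ?Euclid_dvdzX // dE dvdzE d'E dvdn_mull.
have -> : 4 * d - c ^+ 2 = 3 by rewrite /d /c; ring.
by rewrite dvdzE dvdn_prime2 // (negPf p3).
Qed.

Let Pd : (P %| d)%Z.
Proof. by have [_ _ pd _] := pk; rewrite dE. Qed.

Lemma norm_form_mod (u v w : int) : (P %| norm_form u v w - u ^+ 3)%Z.
Proof.
rewrite /norm_form; have [g' -> _] := gE; have /dvdzP[d' ->] := Pd.
apply/dvdzP; exists (6 * d' * u ^+ 2 * w - 3 * d' * u * v ^+ 2 + 3 * g' * u * v * w
  + 9 * d' ^+ 2 * P * u * w ^+ 2 - g' * v ^+ 3 + 3 * d' * (P * g') * v * w ^+ 2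
  + P * g' ^+ 2 * w ^+ 3).
by ring.
Qed.

(* Eisenstein: comparing the powers of p in norms removes p from u, then from *)
(* v, then from w.                                                            *)
Lemma dvd_lin (x : L) (u v w : int) : O x -> P%:~R * x = lin u v w ->
  [/\ P %| u, P %| v & P %| w]%Z.
Proof.
have [g' g'E Pg'] := gE; have /dvdzP[d' d'E] := Pd.
have N3 (z : L) (a b e : int) : O z -> P%:~R * z = lin a b e ->
    exists t, norm_form a b e = t * P ^+ 3.
  move=> Oz zE; have [t tE] := cnorm_OK Oz; exists t.
  by apply: (@intr_fext_inj L); rewrite -cnorm_lin -zE cnormM cnorm_int tE; ring.
move=> Ox xE.
have Pu : (P %| u)%Z.
  rewrite -(@Euclid_dvdzX _ 3) // -(rpredDl _ (norm_form_mod u v w)).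
  have [t tE] := N3 _ _ _ _ Ox xE.
  by rewrite subrK tE exprS mulrCA dvdz_mulr.
have /dvdzP[u' u'E] := Pu.
have xE1 : P%:~R * (x - u'%:~R) = lin 0 v w.
  by rewrite mulrBr xE /lin u'E; ring.
have Ox1 := OK_sub Ox (OK_int L u').
have Pv : (P %| v)%Z.
  have [t tE] := N3 _ _ _ _ Ox1 xE1.
  have E : P * (t * P ^+ 2) = P * (g' * (- v ^+ 3 + 3 * d * v * w ^+ 2 + g * w ^+ 3)).
    have -> : P * (t * P ^+ 2) = t * P ^+ 3 by ring.
    by rewrite -tE mulrA -g'E /norm_form; ring.
  move/(mulfI P0) in E.
  have : (P %| g' * (- v ^+ 3 + 3 * d * v * w ^+ 2 + g * w ^+ 3))%Z.
    by rewrite -E dvdz_mull // dvdz_exp.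
  rewrite Euclid_dvdzM // (negPf Pg') /= -addrA addrC rpredDl.
    by rewrite rpredN Euclid_dvdzX.
  rewrite rpredD // ?g'E ?d'E.
    by rewrite -!mulrA dvdz_mull // dvdz_mull // dvdz_mulr.
  by rewrite -mulrA dvdz_mulr.
have /dvdzP[v' v'E] := Pv.
have xE2 : P%:~R * (x - u'%:~R - v'%:~R * y) = lin 0 0 w.
  by rewrite mulrBr xE1 /lin v'E; ring.
have Ox2 := OK_sub Ox1 (OK_mul (OK_int L v') OK_y).
split=> //.
have [t tE] := N3 _ _ _ _ Ox2 xE2.
have E : P ^+ 2 * (t * P) = P ^+ 2 * (g' ^+ 2 * w ^+ 3).
  have -> : P ^+ 2 * (t * P) = t * P ^+ 3 by ring.
  by rewrite -tE mulrA -exprMn -g'E /norm_form; ring.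
move/(mulfI (expf_neq0 2 P0)) in E.
have : (P %| g' ^+ 2 * w ^+ 3)%Z by rewrite -E dvdz_mull.
by rewrite Euclid_dvdzM // !Euclid_dvdzX // (negPf Pg').
Qed.

(** So 1, y, y^2 generate the integers locally at p: [dvd_lin] cancels p from any denominator, and
    the descent is on its absolute value. *)
Lemma OK_rep (x : L) : O x ->
  exists e u v w : int, ~~ (P %| e)%Z /\ e%:~R * x = lin u v w.
Proof.
move=> Ox; have [e [u [v [w [e0 E]]]]] := gen x.
elim/ltn_ind: {e}`|e|%N {-2}e (erefl `|e|%N) u v w e0 E => n IH e en u v w e0 E.
have [/dvdzP[e' e'E]|] := boolP (P %| e)%Z; last by exists e, u, v, w.
have Pe' : P%:~R * (e'%:~R * x) = lin u v w by rewrite -E e'E; ring.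
have [/dvdzP[u' u'E] /dvdzP[v' v'E] /dvdzP[w' w'E]] :=
  dvd_lin (OK_mul (OK_int L e') Ox) Pe'.
have e'0 : e' != 0 by apply: contraNneq e0 => e0; rewrite e'E e0 mul0r.
apply: (IH `|e'|%N _ e' erefl u' v' w') => //.
  rewrite -en e'E abszM ltn_Pmulr ?prime_gt1 // lt0n absz_eq0 //.
apply: (@mulfI _ P%:~R); first by rewrite intr_fext_eq0.
by rewrite Pe' u'E v'E w'E /lin; ring.
Qed.

(* As p is totally ramified, P_p consists of the integers whose norm p divides. *)
Definition prime_over : set L :=
  [set x | O x /\ exists t : int, cnorm x = (t * P)%:~R].

(** e^3 times the norm of x is u^3 modulo p. Membership thus becomes linear in the coordinates,
    which yields closure under addition. *)
Lemma prime_over_rep (x : L) (e u v w : int) : O x -> ~~ (P %| e)%Z ->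
  e%:~R * x = lin u v w -> prime_over x <-> (P %| u)%Z.
Proof.
move=> Ox Pe xE; have [t tE] := cnorm_OK Ox.
have E : e ^+ 3 * t = norm_form u v w.
  by apply: (@intr_fext_inj L); rewrite -cnorm_lin -xE cnormM cnorm_int tE; ring.
have -> : (P %| u)%Z = (P %| t)%Z.
  rewrite -(@Euclid_dvdzX _ 3) // -(rpredDl _ (norm_form_mod u v w)) subrK -E.
  by rewrite Euclid_dvdzM // Euclid_dvdzX // (negPf Pe).
split=> [[_ [t']]|/dvdzP[t' t'E]]; last by split=> //; exists t'; rewrite tE t'E.
by rewrite tE => /intr_fext_inj ->; rewrite dvdz_mull.
Qed.

Lemma prime_over_sub : OK_submodule prime_over.
Proof.
split.
- by split; [exact: (OK_int L 0) | exists 0; rewrite /cnorm !mul0r].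
- move=> x x' Px Px'; have [Ox Ox'] := (proj1 Px, proj1 Px').
  have [e [u [v [w [Pe E]]]]] := OK_rep Ox.
  have [e' [u' [v' [w' [Pe' E']]]]] := OK_rep Ox'.
  have /(_ Px) Pu := proj1 (prime_over_rep Ox Pe E).
  have /(_ Px') Pu' := proj1 (prime_over_rep Ox' Pe' E').
  apply/(@prime_over_rep _ (e * e') (e' * u + e * u') (e' * v + e * v')
           (e' * w + e * w')).
  + exact: OK_add.
  + by rewrite Euclid_dvdzM // negb_or Pe.
  + transitivity (e'%:~R * (e%:~R * x) + e%:~R * (e'%:~R * x')); first by ring.
    by rewrite E E' /lin; ring.
  + by rewrite rpredD // dvdz_mull.
move=> a x Oa Px; have Ox := proj1 Px; split; first exact: OK_mul.
have [b bE] := cnorm_OK Oa; case: Px => _ [t tE].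
by exists (b * t); rewrite cnormM bE tE; ring.
Qed.

Lemma prime_over_int (a : int) : prime_over a%:~R <-> (P %| a)%Z.
Proof.
apply: (@prime_over_rep _ 1 a 0 0); first exact: OK_int.
  by rewrite dvdz1 /=; apply: contraTneq pp => ->.
by rewrite /lin; ring.
Qed.

(** x is congruent to u / e, with e inverted modulo p by Bezout. *)
Lemma prime_over_residue (x : L) : O x -> exists a : int, prime_over (x - a%:~R).
Proof.
move=> Ox; have [e [u [v [w [Pe E]]]]] := OK_rep Ox.
have co : coprimez P e by rewrite coprimezE prime_coprime.
have [i [j ij]] := Bezoutz P e; rewrite (eqP co) in ij.
exists (j * u); apply/(@prime_over_rep _ e (u - e * (j * u)) v w) => //.
- by apply: OK_sub => //; exact: OK_int.
- by rewrite mulrBr E /lin; ring.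
have -> : u - e * (j * u) = i * u * P.
  by rewrite -{1}[u]mulr1 -ij; ring.
exact: dvdz_mull.
Qed.

Lemma cnorm_residue (x : L) : O x ->
  exists t a : int, cnorm x = t%:~R /\ (P %| a ^+ 3 - t)%Z.
Proof.
move=> Ox; have [a Pxa] := prime_over_residue Ox; have [t tE] := cnorm_OK Ox.
exists t, a; split=> //.
have [e [u [v [w [Pe E]]]]] := OK_rep Ox.
have E' : e%:~R * (x - a%:~R) = lin (u - e * a) v w by rewrite mulrBr E /lin; ring.
have Pua := proj1 (prime_over_rep (proj1 Pxa) Pe E') Pxa.
have NE : e ^+ 3 * t = norm_form u v w.
  by apply: (@intr_fext_inj L); rewrite -cnorm_lin -E cnormM cnorm_int tE; ring.
have : (P %| e ^+ 3 * (a ^+ 3 - t))%Z.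
  have -> : e ^+ 3 * (a ^+ 3 - t) = - ((norm_form u v w - u ^+ 3)
      + (u - e * a) * (u ^+ 2 + u * (e * a) + (e * a) ^+ 2)).
    by rewrite -NE; ring.
  by rewrite rpredN rpredD ?norm_form_mod ?dvdz_mulr.
by rewrite Euclid_dvdzM // Euclid_dvdzX // (negPf Pe).
Qed.

Lemma prime_over_y : prime_over y.
Proof.
apply/(@prime_over_rep _ 1 0 1 0); [exact: OK_y | | by rewrite /lin; ring | by []].
by rewrite dvdz1 /=; apply: contraTneq pp => ->.
Qed.

Lemma prime_over_prime : prime_ideal prime_over.
Proof.
split; [split; [exact: prime_over_sub | by move=> x []] | |].
  by move/(prime_over_int 1); rewrite dvdz1 /= => /eqP p1; move: pp; rewrite p1.
move=> a b Oa Ob [_ [t]]; rewrite cnormM.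
have [i iE] := cnorm_OK Oa; have [j jE] := cnorm_OK Ob.
rewrite iE jE -rmorphM => /intr_fext_inj E.
have : (P %| i * j)%Z by rewrite E dvdz_mull.
rewrite Euclid_dvdzM // => /orP[] /dvdzP[q qE]; [left | right]; split=> //.
  by exists q; rewrite iE qE.
by exists q; rewrite jE qE.
Qed.

Lemma prime_over_norm : ideal_norm prime_over = p.
Proof.
apply: ideal_norm_residues.
- exact: prime_over_sub.
- exact: prime_gt0.
- exact: prime_over_residue.
- exact: prime_over_int.
Qed.

(** Q contains p, hence y^3 = 3 d y - g, hence y, hence P_p by [OK_rep]. Conversely x in Q is
    congruent modulo P_p to an integer a in Q, and p divides a since 1 is not in Q. *)
Lemma prime_over_unique (Q : set L) :
  prime_ideal Q -> ideal_norm Q = p -> Q = prime_over.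
Proof.
move=> [[subQ QO] Q1 Qpr] Qp; have [_ QD QM] := subQ.
have pQ : Q P%:~R by apply: ideal_norm_mem Qp => //; exact: prime_gt0.
have intQ (a : int) : (P %| a)%Z -> Q a%:~R.
  by case/dvdzP=> b ->; rewrite rmorphM; apply: QM => //; exact: OK_int.
have yQ : Q y.
  have Q3 : Q (y ^+ 3).
    rewrite y3; apply: OK_submoduleB => //.
      by rewrite mulrC; apply: QM; [exact: OK_y | apply: intQ; rewrite dvdz_mull].
    by apply: intQ; rewrite dvdz_mull.
  move: Q3; rewrite exprS => /Qpr[||//|]; [exact: OK_y | exact: OK_exp OK_y |].
  by rewrite expr2 => /Qpr[||//|//]; exact: OK_y.
have PQ : prime_over `<=` Q.
  move=> x Px; have Ox := proj1 Px.
  have [e [u [v [w [Pe E]]]]] := OK_rep Ox.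
  have Pu := proj1 (prime_over_rep Ox Pe E) Px.
  apply: (@OK_submodule_coprime _ _ subQ P e); first by rewrite coprimezE prime_coprime.
    by rewrite mulrC; apply: QM.
  rewrite E /lin; apply: (QD); first apply: (QD).
  - exact: intQ.
  - by apply: QM => //; exact: OK_int.
  - by rewrite expr2 mulrA; apply: QM => //; apply: OK_mul; [exact: OK_int | exact: OK_y].
apply/seteqP; split=> // x Qx; have Ox := QO _ Qx.
have [a Pxa] := prime_over_residue Ox.
have Qa : Q a%:~R.
  by rewrite -[_%:~R](subKr x); apply: OK_submoduleB => //; exact: PQ.
have Pa : (P %| a)%Z.
  apply: contra_notT Q1 => Pa; apply: (@OK_submodule_coprime _ _ subQ P a).
  - by rewrite coprimezE prime_coprime.
  - by rewrite mulr1.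
  - by rewrite mulr1.
rewrite -[x](subrK a%:~R); case: prime_over_sub => _ PD _.
by apply: PD => //; apply/prime_over_int.
Qed.

Lemma Pi_ideal_prime_over : @Pi_ideal L p = prime_over.
Proof.
have -> : @Pi_ideal L p = ideal_mul prime_over O.
  rewrite /Pi_ideal.
  have -> : [set Q | prime_ideal Q /\ ideal_norm Q = p] = [set prime_over].
    apply/seteqP; split=> Q /=; first by case; exact: prime_over_unique.
    by move=> ->; split; [exact: prime_over_prime | exact: prime_over_norm].
  have -> : fset_set [set prime_over] = [:: prime_over] :> seq (set L).
    rewrite fset_set1; apply/perm_small_eq => //.
    by apply: uniq_perm; [exact: fset_uniq | by [] | move=> C; rewrite !inE].
  by rewrite big_cons big_nil.
have [P0' PD PM] := prime_over_sub.
apply/seteqP; split=> x.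
  move=> [r [rP ->]]; apply: (OK_submodule_sum prime_over_sub) => i /rP[Pi Oi].
  by rewrite mulrC; apply: PM.
move=> Px; exists [:: (x, 1)]; split; last by rewrite big_seq1 mulr1.
by move=> i; rewrite inE => /eqP->; split=> //; exact: (OK_int L 1).
Qed.

(** P_p contains p and y, whose norms p^3 and - p g' have greatest common divisor p. *)
Lemma cnorm_scale (a : L) (m : int) :
  (forall x, prime_over x -> exists t : int, cnorm (a * x) = (t * m)%:~R) ->
  exists t : int, cnorm a * P%:~R = (t * m)%:~R.
Proof.
move=> H; have [g' g'E Pg'] := gE.
have [t1] := H _ (proj2 (prime_over_int P) (dvdzz _)).
rewrite cnormM cnorm_int => E1.
have [t2] := H _ prime_over_y; rewrite cnormM.
have -> : cnorm y = (- (P * g'))%:~R.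
  have -> : y = lin 0 1 0 by rewrite /lin; ring.
  by rewrite cnorm_lin -g'E /norm_form; congr (intmul _ _); ring.
move=> E2.
have co : coprimez (P ^+ 2) g' by rewrite coprimezE abszX coprimeXl // prime_coprime.
have [i [j ij]] := Bezoutz (P ^+ 2) g'; rewrite (eqP co) in ij.
exists (i * t1 - j * t2).
transitivity (cnorm a * P%:~R * (i * P ^+ 2 + j * g')%:~R); first by rewrite ij mulr1.
transitivity (i%:~R * (cnorm a * (P ^+ 3)%:~R) - j%:~R * (cnorm a * (- (P * g'))%:~R)).
  by ring.
by rewrite E1 E2; ring.
Qed.

(** Up to a denominator prime to p, x is u + y b with p dividing both u and y^3. *)
Lemma prime_over_cube (x : L) : prime_over x ->
  exists2 z : L, O z & x ^+ 3 = P%:~R * z.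
Proof.
move=> Px; have Ox := proj1 Px.
pose J := [set z : L | exists2 z', O z' & z = P%:~R * z'].
suff : J (x ^+ 3) by [].
have subJ : OK_submodule J.
  split; first by exists 0; [exact: (OK_int L 0) | rewrite mulr0].
    move=> _ _ [a Oa ->] [b Ob ->]; exists (a + b); first exact: OK_add.
    by rewrite mulrDr.
  move=> a _ Oa [b Ob ->]; exists (a * b); first exact: OK_mul.
  by rewrite mulrCA.
have [e [u [v [w [Pe E]]]]] := OK_rep Ox.
have /dvdzP[u' u'E] := proj1 (prime_over_rep Ox Pe E) Px.
have [g' g'E _] := gE; have /dvdzP[d' d'E] := Pd.
apply: (@OK_submodule_coprime _ _ subJ P (e ^+ 3)).
- by rewrite coprimezE abszX coprimeXr // prime_coprime.
- by exists (x ^+ 3) => //; exact: OK_exp.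
pose m := v%:~R * y + w%:~R * y ^+ 2; pose b := v%:~R + w%:~R * y.
exists (u'%:~R * (u%:~R ^+ 2 + 3 * u%:~R * m + 3 * m ^+ 2)
        + ((3 * d')%:~R * y - g'%:~R) * b ^+ 3).
  have Oy := OK_y; have Oi := OK_int L.
  have Om : O m by apply: OK_add; apply: OK_mul => //; exact: OK_exp.
  have Ob : O b by apply: OK_add => //; exact: OK_mul.
  apply: OK_add; apply: OK_mul => //.
  - apply: OK_add; last by apply: OK_mul (Oi 3) _; exact: OK_exp.
    apply: OK_add; first exact: OK_exp.
    by apply: OK_mul => //; exact: OK_mul (Oi 3) _.
  - by apply: OK_sub => //; exact: OK_mul.
  - exact: OK_exp.
transitivity ((e%:~R * x) ^+ 3); first by ring.
have -> : e%:~R * x = u%:~R + m by rewrite E /lin /m; ring.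
have mE : m ^+ 3 = y ^+ 3 * b ^+ 3 by rewrite /m /b; ring.
transitivity (u%:~R * (u%:~R ^+ 2 + 3 * u%:~R * m + 3 * m ^+ 2) + m ^+ 3); first by ring.
by rewrite mE y3 d'E g'E {1}u'E; ring.
Qed.

End Ramified.

(** * Distinct classes, and a bound on detectable primes *)

Lemma prime_over_class_neq (p p' q : nat) :
  ramified p k -> ramified p' k -> ramified q k -> cube_separated p p' q ->
  ideal_class (prime_over p) <> ideal_class (prime_over p').
Proof.
move=> rp rp' rq [qp qp' sep] E.
have pp : prime p by case: rp.
have pp' : prime p' by case: rp'.
have [a a0 Ia] : ideal_class (prime_over p') (prime_over p).
  rewrite -E; exists 1; first exact: oner_neq0.
  by apply/seteqP; split=> x; [exists x; rewrite ?mul1r | case=> z Pz <-; rewrite mul1r].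
have aI x : prime_over p' x -> prime_over p (a * x) by move=> Px; rewrite Ia; exists x.
have Ia' x : prime_over p x -> prime_over p' (a^-1 * x).
  by rewrite Ia => -[z Pz <-]; rewrite mulKf.
(* Scaling by a and by its inverse gives N(a) p' = A p and N(1/a) p = B p', so A is a unit of the
   rational integers. *)
have [A AE] := cnorm_scale rp' (fun x Px => proj2 (aI x Px)).
have [B BE] := cnorm_scale rp (fun x Px => proj2 (Ia' x Px)).
have AB : A * B = 1.
  have pp0 : p%:Z * p'%:Z != 0 by rewrite mulf_neq0 // -lt0n prime_gt0.
  apply: (mulIf pp0); rewrite mul1r; apply: (@intr_fext_inj L).
  transitivity ((A * p%:Z)%:~R * (B * p'%:Z)%:~R : L); first by ring.
  rewrite -AE -BE.
  have -> : cnorm a * p'%:~R * (cnorm a^-1 * p%:~R)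
      = cnorm (a * a^-1) * (p%:~R * p'%:~R) by rewrite cnormM; ring.
  by rewrite divff // cnorm1 rmorphM mul1r.
have Pp' : prime_over p' p'%:~R by apply/(prime_over_int rp').
have Ob : O (a * p'%:~R) by exact: (proj1 (aI _ Pp')).
have [t [c0 [tE dt]]] := cnorm_residue rq Ob.
have tA : t = A * (p * p' ^ 2)%N%:Z.
  apply: (@intr_fext_inj L); rewrite -tE cnormM cnorm_int.
  transitivity (cnorm a * p'%:~R * p'%:~R ^+ 2); first by ring.
  by rewrite AE; ring.
have : A = 1 \/ A = - 1.
  move/(congr1 absz): AB; rewrite abszM => /eqP; rewrite muln_eq1.
  by case/andP => /eqP + _; lia.
case=> A1; rewrite A1 ?mul1r ?mulN1r in tA.
  by have /negP := sep c0; rewrite -tA.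
(* The sign is harmless because -1 is a cube. *)
have /negP := sep (- c0); apply.
have -> : (- c0) ^+ 3 - (p * p' ^ 2)%N%:Z = - (c0 ^+ 3 - t) by rewrite tA; ring.
by rewrite rpredN.
Qed.

(** Both y and its conjugate are congruent to a modulo nilpotents of O / r O, so y - s y is
    nilpotent there and r divides its norm - 9 d, whose square is the discriminant of the cubic of
    y. *)
Lemma unramified_not_cube (r : nat) : prime r ->
  (forall x, O x -> exists a : int, exists2 z : L, O z & (x - a%:~R) ^+ 3 = r%:~R * z) ->
  (r %| 9 * cyc3 k)%N.
Proof.
move=> pr H; have [a [z Oz zE]] := H _ OK_y.
pose A := y - a%:~R; pose B := s y - a%:~R; pose x := A - B.
have BE : B ^+ 3 = r%:~R * s z.
  have -> : B = s A by rewrite rmorphB rmorph_int.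
  by rewrite -rmorphXn zE rmorphM rmorph_int.
have OA : O A := OK_sub OK_y (OK_int L a).
have Os b : O b -> O (s b) := proj1 (OK_morph s b).
have OB : O B := OK_sub (Os _ OK_y) (OK_int L a).
have Osz := Os _ Oz.
(* Every term of (A - B)^5 contains A^3 or B^3; [w] collects the cofactors. *)
pose w := z * (A ^+ 2 - 5%:~R * (A * B) + 10%:~R * B ^+ 2)
        + s z * (- 10%:~R * A ^+ 2 + 5%:~R * (A * B) - B ^+ 2).
have Ow : O w.
  have OA2 := OK_exp 2 OA; have OB2 := OK_exp 2 OB; have OAB := OK_mul OA OB.
  have Oi := OK_int L.
  apply: OK_add; apply: OK_mul => //.
    by apply: OK_add; [apply: OK_sub => // | ]; exact: OK_mul.
  apply: OK_sub => //; apply: OK_add; last exact: OK_mul.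
  by apply: OK_mul => //; exact: OK_opp.
have x5 : x ^+ 5 = r%:~R * w.
  transitivity (A ^+ 3 * (A ^+ 2 - 5%:~R * (A * B) + 10%:~R * B ^+ 2)
        + B ^+ 3 * (- 10%:~R * A ^+ 2 + 5%:~R * (A * B) - B ^+ 2)); first by rewrite /x; ring.
  by rewrite zE BE /w; ring.
have xE : x = lin (2 * d) (1 - k%:Z) (- 1) by rewrite /x /A /B sy /lin; ring.
have Nx : cnorm x = (norm_form (2 * d) (1 - k%:Z) (- 1))%:~R by rewrite xE cnorm_lin.
have [t tE] := cnorm_OK Ow.
have Nx5 : cnorm (x ^+ 5) = cnorm x ^+ 5 by rewrite !exprS !cnormM cnorm1.
have E : norm_form (2 * d) (1 - k%:Z) (- 1) ^+ 5 = r%:Z ^+ 3 * t.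
  apply: (@intr_fext_inj L); rewrite rmorphXn /= -Nx -Nx5 x5 cnormM cnorm_int tE.
  by ring.
have : (r%:Z %| norm_form (2 * d) (1 - k%:Z) (- 1))%Z.
  by rewrite -(@Euclid_dvdzX _ 5) // E exprS -mulrA dvdz_mulr.
have -> : norm_form (2 * d) (1 - k%:Z) (- 1) = - (9 * d).
  by rewrite /norm_form /g /c /d; ring.
rewrite rpredN.
have -> : 9 * d = (9 * cyc3 k)%N%:Z by rewrite /d /cyc3; lia.
by [].
Qed.

End Cubic.

(** * The simplest cubic fields *)

Definition shanks_int (n : int) : {poly int} := 'X^3 + (n + 3) *: 'X^2 + n *: 'X - 1.

Lemma shanks_polyE (n : int) : shanks_poly n = map_poly intr (shanks_int n).
Proof.
apply/polyP => i; rewrite coef_map /= /shanks_poly /shanks_int !coefE.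
by case: i => [|[|[|[|i]]]] //=; ring.
Qed.

Lemma shanks_int_low (n : int) :
  (size ((n + 3) *: 'X^2 + (n *: 'X - 1) : {poly int})%R < size ('X^3 : {poly int}))%N.
Proof.
rewrite size_polyXn (leq_ltn_trans (size_polyD _ _)) // gtn_max.
rewrite (leq_ltn_trans (size_scale_leq _ _)) ?size_polyXn //=.
rewrite (leq_ltn_trans (size_polyD _ _)) // gtn_max.
by rewrite (leq_ltn_trans (size_scale_leq _ _)) ?size_polyX // size_polyN size_poly1.
Qed.

Lemma monic_shanks_int (n : int) : shanks_int n \is monic.
Proof.
by rewrite monicE /shanks_int -!addrA lead_coefDl ?shanks_int_low ?lead_coefXn.
Qed.

Lemma size_shanks_poly (n : int) : size (shanks_poly n) = 4%N.
Proof.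
rewrite shanks_polyE size_map_poly_id0 ?(monicP (monic_shanks_int n)) ?oner_neq0 //.
by rewrite /shanks_int -!addrA size_polyDl ?shanks_int_low // size_polyXn.
Qed.

(** A rational root would be 1 or -1, where the values are the odd number 2 n + 3 and 1. *)
Lemma irreducible_shanks_poly (n : int) : irreducible_poly (shanks_poly n).
Proof.
apply: cubic_irreducible; first by rewrite size_shanks_poly.
move=> r; apply/negP => rr; have [|t tE] := @integral_rat_int r.
  by exists (shanks_int n); [exact: monic_shanks_int | rewrite -shanks_polyE].
have E : t * (t ^+ 2 + (n + 3) * t + n) = 1.
  apply: (@intr_inj rat); move/rootP: rr; rewrite /shanks_poly.
  rewrite !(hornerD, hornerN, hornerZ, hornerXn, hornerX, hornerC) tE => E.
  by apply/eqP; rewrite -subr_eq0 -[X in _ == X]E; apply/eqP; ring.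
have : `|t|%N = 1%N.
  by move/(congr1 absz): E; rewrite abszM => /eqP; rewrite muln_eq1 => /andP[/eqP].
move=> t1; have [] : t = 1 \/ t = -1 by lia.
  by move=> t1'; move: E; rewrite t1'; lia.
by move=> t1'; move: E; rewrite t1'; lia.
Qed.

(* The roots of the polynomial are r, - 1 / (1 + r) = r^2 + (n + 2) r - 2 and *)
(* its conjugate.                                                             *)
Section Roots.
Variables (L : fieldExtType rat) (n : int) (r : L).
Let F : {poly L} := map_poly (in_alg L) (shanks_poly n).
Hypothesis Fr : root F r.
Let N : L := n%:~R.
Let r1 : L := r ^+ 2 + (N + 2) * r - 2.
Let r2 : L := - (N + 3) - r - r1.

Let FE : F = 'X^3 + (N + 3)%:P * 'X^2 + N%:P * 'X - 1.
Proof.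
have inE (a : int) : (a%:~R)%:A = a%:~R :> L by exact: (rmorph_int (in_alg L)).
rewrite /F /shanks_poly rmorphB rmorphD rmorphD rmorph1 /=.
rewrite !map_polyZ /= !map_polyXn map_polyX !inE -!mul_polyC /N.
by congr (_ + _ * _ + _ - _); congr (_%:P); ring.
Qed.

Lemma shanks_root_eq : r ^+ 3 + (N + 3) * r ^+ 2 + N * r - 1 = 0.
Proof. by move/rootP: Fr; rewrite FE !hornerE. Qed.

Lemma shanks_poly_factor : F = ('X - r%:P) * ('X - r1%:P) * ('X - r2%:P).
Proof.
set h := r ^+ 3 + (N + 3) * r ^+ 2 + N * r - 1.
have h0 : h = 0 by exact: shanks_root_eq.
(* Both symmetric functions agree with the coefficients up to an explicit multiple of [h]. *)
have e2 : r * r1 + r * r2 + r1 * r2 = N.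
  by rewrite -[RHS]addr0 -(mulr0 (- (r + N + 2))) -h0 /h /r2 /r1; ring.
have e3 : r * r1 * r2 = 1.
  by rewrite -[RHS]addr0 -(mulr0 (- (1 + r1))) -h0 /h /r2 /r1; ring.
transitivity ('X^3 - (r + r1 + r2)%:P * 'X^2 + (r * r1 + r * r2 + r1 * r2)%:P * 'X
  - (r * r1 * r2)%:P : {poly L}); last by ring.
rewrite e2 e3 FE; have -> : r + r1 + r2 = - (N + 3) by rewrite /r2; ring.
by rewrite polyC1 polyCN mulNr opprK.
Qed.

End Roots.

Lemma rat_common_denominator (a b c : rat) : exists e u v w : int,
  [/\ e != 0, e%:~R * a = u%:~R, e%:~R * b = v%:~R & e%:~R * c = w%:~R].
Proof.
have den q : (denq q)%:~R * q = (numq q)%:~R by rewrite mulrC -numqE.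
exists (denq a * denq b * denq c), (denq b * denq c * numq a),
  (denq a * denq c * numq b), (denq a * denq b * numq c); split.
- by rewrite !mulf_neq0 // denq_neq0.
- by rewrite [RHS]rmorphM /= -den; ring.
- by rewrite [RHS]rmorphM /= -den; ring.
- by rewrite [RHS]rmorphM /= -den; ring.
Qed.

(** Adjoining one root r suffices, the others being polynomials in it. With n = 3 k the shift y = r
    + k + 1 has integer coefficients and trace 0; s extends r -> r1. *)
Lemma simplest_cubic_field_exists (k : nat) :
  exists (L : fieldExtType rat) (y : L) (s : {rmorphism L -> L}),
  let d : int := k%:Z ^+ 2 + k%:Z + 1 in
  [/\ is_simplest_cubic_field (3 * k%:Z) L,
      y ^+ 3 = (3 * d)%:~R * y - ((2 * k%:Z + 1) * d)%:~R,
      s y = y ^+ 2 + k%:~R * y - (2 * d)%:~R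
    & forall x : L, exists e u v w : int,
        e != 0 /\ e%:~R * x = u%:~R + v%:~R * y + w%:~R * y ^+ 2].
Proof.
set n : int := 3 * k%:Z.
have [L dimL [r Fr genL]] := irredp_FAdjoin (irreducible_shanks_poly n).
rewrite size_shanks_poly /= in dimL.
pose N : L := n%:~R; pose r1 : L := r ^+ 2 + (N + 2) * r - 2.
have fac := shanks_poly_factor Fr; rewrite -/N -/r1 in fac.
have rE := shanks_root_eq Fr; rewrite -/N in rE.
set F := map_poly (in_alg L) (shanks_poly n) in Fr fac.
have deg : adjoin_degree 1 r = 3%N.
  by have := dim_Fadjoin 1 r; rewrite genL dimL dimv1 muln1.
have mF : minPoly 1 r %= F.
  rewrite -dvdp_size_eqp; last first.
    apply: minPoly_dvdp => //; apply/polyOverP => i; rewrite coef_map /=.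
    by rewrite rpredZ // mem1v.
  by rewrite size_minPoly deg size_map_poly size_shanks_poly.
have r1root : root (map_poly \1%VF (minPoly 1 r)) r1.
  by rewrite lfun1_poly (eqp_root mF) fac !rootM !root_XsubC eqxx orbT.
pose f := kHomExtend 1 \1 r r1.
have fhom : kHom 1 {:L} f.
  by rewrite -genL; apply: kHomExtendP => //; exact: kHom1.
have fr : f r = r1 by apply: (kHomExtend_val (kHom1 1 1)).
have fM : monoid_morphism f.
  by have /kHom_lrmorphism[f1 f2] := fhom; split.
pose fadd := GRing.isZmodMorphism.Build L L f (linearB f).
pose fmul := GRing.isMonoidMorphism.Build L L f fM.
pose s : {rmorphism L -> L} := HB.pack (fun_of_lfun f) fadd fmul.
pose K : L := k%:~R.
have NK : N = 3 * K by rewrite /N /K /n; ring.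
exists L, (r + K + 1), s => d.
have dE : d%:~R = K ^+ 2 + K + 1 :> L by rewrite /d /K; ring.
split.
- rewrite /is_simplest_cubic_field.
  exists [:: r; r1; - (N + 3) - r - r1].
    by rewrite -/F fac !big_cons big_nil mulr1 mulrA eqpxx.
  by apply/eqP; rewrite eqEsubv subvf /= adjoin_cons genL subv_adjoin_seq.
- rewrite !rmorphM /= dE; apply/eqP; rewrite -subr_eq0 -[X in _ == X]rE NK /K.
  by apply/eqP; ring.
- have -> : s (r + K + 1) = r1 + K + 1.
    by rewrite !rmorphD rmorph1 rmorph_int /= fr.
  by rewrite rmorphM /= dE /r1 NK /K; ring.
move=> x; have xL : x \in <<1; r>>%VS by rewrite genL memvf.
pose p := Fadjoin_poly 1 r x.
have szp : (size p <= 3)%N by rewrite -deg size_Fadjoin_poly.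
have pK i : exists a : rat, p`_i = in_alg L a.
  by have /polyOverP/(_ i)/vlineP := Fadjoin_polyOver 1 r x.
have [a aE] := pK 0%N; have [b bE] := pK 1%N; have [c cE] := pK 2%N.
have [e [u [v [w [e0 ea eb ec]]]]] := rat_common_denominator a b c.
have inE (q : rat) (t : int) : e%:~R * q = t%:~R -> e%:~R * in_alg L q = t%:~R.
  by move=> E; rewrite -(rmorph_int (in_alg L)) -rmorphM E rmorph_int.
have xE : e%:~R * x = u%:~R + v%:~R * r + w%:~R * r ^+ 2.
  rewrite -(Fadjoin_poly_eq xL) -/p (horner_coef_wide r szp).
  rewrite !big_ord_recr big_ord0 /= aE bE cE -(inE _ _ ea) -(inE _ _ eb) -(inE _ _ ec).
  by ring.
(* The coordinates come from substituting r = y - (k + 1). *)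
exists e, (u - v * (k%:Z + 1) + w * (k%:Z + 1) ^+ 2), (v - 2 * w * (k%:Z + 1)), w.
by split=> //; rewrite xE /K; ring.
Qed.

(* Every integer of K is congruent to a rational one modulo a nilpotent of    *)
(* O / r O: for large r this detects total ramification.                      *)
Definition cube_residues (r : nat) (K : fieldExtType rat) : Prop :=
  forall x : K, ring_of_integers x ->
  exists a : int, exists2 z, ring_of_integers z & (x - a%:~R) ^+ 3 = r%:~R * z.

Lemma cube_residues_iso (r : nat) (K L : fieldExtType rat) :
  field_isomorphic K L -> cube_residues r K <-> cube_residues r L.
Proof.
move=> [f [g fK gK]]; split=> H x Ox.
  have Og : ring_of_integers (g x) by apply/(OK_morph f); rewrite gK.
  have [a [z Oz E]] := H _ Og; exists a, (f z); first by apply/(OK_morph f).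
  have := congr1 f E.
  by rewrite rmorphXn rmorphB rmorphM !rmorph_int gK.
have [a [z Oz E]] := H (f x) (proj1 (OK_morph f x) Ox).
exists a, (g z); first by apply/(OK_morph f); rewrite gK.
apply: (can_inj fK).
by rewrite rmorphXn rmorphB rmorphM !rmorph_int gK.
Qed.

(** * Large Polya groups in infinitely many fields *)

Lemma Pi_class_polya (K : fieldExtType rat) (p : nat) :
  prime p -> polya_group K (ideal_class (@Pi_ideal K p)).
Proof.
move=> pp H [_ HG]; apply: HG; exists p => //.
by exists p, 1%N; rewrite expn1.
Qed.

(** The last two clauses serve to tell fields apart: a detectable prime above B, and a bound on all
    detectable primes. *)
Lemma exists_good_field (t B : nat) :
  exists (n : nat) (K : fieldExtType rat),
  [/\ is_simplest_cubic_field (3 * n%:Z) K,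
      exists cs : seq (set (set K)),
        [/\ size cs = t.+1, uniq cs & {in cs, forall c, polya_group K c}],
      exists r, [/\ prime r, (B < r)%N & cube_residues r K]
    & forall r, prime r -> cube_residues r K -> (r <= 9 * cyc3 n)%N].
Proof.
have [k [ps [sz Ups rps sep [r [Br rk]]]]] := exists_config t B.
have [K [y [s [simp y3 sy gen]]]] := simplest_cubic_field_exists k.
exists k, K; split=> //.
- exists [seq ideal_class (prime_over s p) | p <- ps]; split.
  + by rewrite size_map.
  + rewrite map_inj_in_uniq // => p p' pps p'ps /eqP; apply: contraTeq => pp'.
    have [q [rq spp]] := sep _ _ pps p'ps pp'.
    apply/eqP; exact: (prime_over_class_neq y3 sy gen (rps _ pps) (rps _ p'ps) rq spp).
  + move=> _ /mapP[p pps ->]; have rp := rps _ pps.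
    rewrite -(Pi_ideal_prime_over y3 sy gen rp).
    by apply: Pi_class_polya; case: rp.
- exists r; split=> //; first by case: rk.
  move=> x Ox; have [a Pxa] := prime_over_residue y3 sy gen rk Ox.
  by exists a; exact: (prime_over_cube y3 sy gen rk Pxa).
move=> r' pr' cr'; apply: dvdn_leq; first by rewrite muln_gt0 /cyc3 addn1.
exact: (unramified_not_cube y3 sy gen pr' cr').
Qed.

Lemma counting_gt (R : realType) (T : choiceType) (A : set T) (cs : seq T) :
  uniq cs -> {in cs, forall c, A c} -> ((size cs)%:R%:E <= counting A :> \bar R)%E.
Proof.
move=> Ucs csA; rewrite /counting; case: asboolP => [fin|_]; last exact: leey.
rewrite lee_fin ler_nat; apply: uniq_leq_size => // c /csA Ac.
by rewrite in_fset_set // inE.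
Qed.

Theorem theorem1p2 (R : realType) (M : R) (hM : 0 < M) :
  exists (n : nat -> int) (K : nat -> fieldExtType rat),
    [/\ forall i, is_simplest_cubic_field (n i) (K i),
        forall i j, i <> j -> ~ field_isomorphic (K i) (K j)
      & forall i, (M%:E < counting (polya_group (K i)))%E].
Proof.
have /choice[G GP] : forall B, exists P : nat * fieldExtType rat,
  [/\ is_simplest_cubic_field (3 * P.1%:Z) P.2,
      exists cs : seq (set (set P.2)),
        [/\ size cs = (Num.bound M).+1, uniq cs & {in cs, forall c, polya_group P.2 c}],
      exists r, [/\ prime r, (B < r)%N & cube_residues r P.2]
    & forall r, prime r -> cube_residues r P.2 -> (r <= 9 * cyc3 P.1)%N].
  move=> B; have [n [K ?]] := exists_good_field (Num.bound M) B.
  by exists (n, K).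
(* [b i.+1] bounds the detectable primes of the i-th field, and the next field has one beyond it. *)
pose b := fix b (i : nat) : nat := if i is j.+1 then (9 * cyc3 (G (b j)).1)%N else 0%N.
have bS i : (b i <= b i.+1)%N.
  have [_ _ [r [pr br cr]] H] := GP (b i).
  exact: leq_trans (ltnW br) (H _ pr cr).
have bmono : {homo b : i j / (i <= j)%N} by apply: homo_leq => //; exact: leq_trans.
exists (fun i => 3 * (G (b i)).1%:Z), (fun i => (G (b i)).2); split.
- by move=> i; have [] := GP (b i).
- have lt_noniso i j : (i < j)%N -> exists2 r,
      cube_residues r (G (b j)).2 & ~ cube_residues r (G (b i)).2.
    move=> ij; have [_ _ [r [pr br cr]] _] := GP (b j); exists r => // cr'.
    have [_ _ _ H] := GP (b i); have := leq_trans (H _ pr cr') (bmono _ _ ij).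
    by rewrite leqNgt br.
  move=> i j /eqP; rewrite neq_ltn => /orP[] /lt_noniso[r c1 c2] iso; apply: c2.
    exact/(cube_residues_iso r iso).
  exact/(cube_residues_iso r iso).
move=> i; have [_ [cs [sz Ucs csP]] _ _] := GP (b i).
apply: lt_le_trans (counting_gt R Ucs csP); rewrite lte_fin sz.
apply: lt_trans (archi_boundP (ltW hM)) _.
by rewrite ltr_nat.
Qed.
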